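(* There is an algorithm $\mathcal{A}$ such that for any $w$-element tree $T$ and any $k\in[w]$, the $N$ many $k$-element subtrees of $T$ get enumerated by $\mathcal{A}$ in time $O(Nw^5)$.
   Context: $[w]=\{1,2,\dots,w\}$. A $w$-element tree is a (finite, undirected, unrooted) tree with $w$ vertices. Subtrees of $T$ are identified with their vertex sets: a $k$-element subtree is a $k$-element set of vertices of $T$ inducing a connected subgraph of $T$. To enumerate a collection of sets means to produce (list) all of them, one by one. The constant implied by $O(\cdot)$ is independent of $T$, $w$ and $k$. *)

(* Defs.v *)
From mathcomp Require Import all_boot.

Set Implicit Arguments.
Unset Strict Implicit.
Unset Printing Implicit Defensive.

(** * Trees and subtrees *)

Section Trees.
Variables (V : finType) (e : rel V).

Definition induced (A : {set V}) : rel V :=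
  [rel x y | [&& x \in A, y \in A & e x y]].

Definition connected_in (A : {set V}) : bool :=
  [forall x in A, forall y in A, connect (induced A) x y].

(* [cycle e [:: x; y]] holds as soon as [e x y] does ([e] being symmetric), so
   only duplicate-free cycles of length at least 3 are graph cycles. *)
Definition acyclic : Prop :=
  forall c : seq V, 2 < size c -> ~~ ucycleb e c.

Definition is_tree : Prop :=
  [/\ symmetric e, irreflexive e, connected_in [set: V] & acyclic].

Definition ksubtrees (k : nat) : {set {set V}} :=
  [set A : {set V} | (#|A| == k) && connected_in A].

End Trees.

(** * Word RAM

    Algorithms are structured programs for a random access machine with
    registers, an indirectly addressed memory and a write-only output stream.
    Every instruction and every test costs one unit of time.  Words are the
    numbers below a bound [B]: an instruction whose result is not below [B] has
    no execution, so arbitrarily large numbers cannot be manipulated at unit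
    cost. *)

Record state := State {
  reg : nat -> nat;
  memory : nat -> nat;
  out : seq nat  (* oldest item first *)
}.

Inductive expr :=
| Cst of nat
| Reg of nat
| Add of nat & nat
| Sub of nat & nat    (* truncated at 0 *)
| Mul of nat & nat
| Read of nat.        (* content of the memory cell addressed by a register *)

Definition eval (ex : expr) (s : state) : nat :=
  match ex with
  | Cst n => n
  | Reg i => reg s i
  | Add i j => reg s i + reg s j
  | Sub i j => reg s i - reg s j
  | Mul i j => reg s i * reg s j
  | Read i => memory s (reg s i)
  end.

Inductive prog :=
| Skip
| Assign of nat & expr
| Store of nat & nat  (* [Store i j]: memory cell addressed by register i := register j *)
| Write of nat
| Seq of prog & prog
| If of nat & prog & prog
| While of nat & prog.

Definition set_reg (s : state) (i v : nat) : state :=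
  State [eta reg s with i |-> v] (memory s) (out s).

Definition set_mem (s : state) (a v : nat) : state :=
  State (reg s) [eta memory s with a |-> v] (out s).

Definition put (s : state) (v : nat) : state :=
  State (reg s) (memory s) (rcons (out s) v).

(* [exec B p s t s']: with words below [B], the program [p] started in [s]
   halts in [s'] after exactly [t] steps.  Tests are true on nonzero words. *)
Inductive exec (B : nat) : prog -> state -> nat -> state -> Prop :=
| exec_skip s : exec B Skip s 1 s
| exec_set i ex s : eval ex s < B ->
    exec B (Assign i ex) s 1 (set_reg s i (eval ex s))
| exec_store i j s :
    exec B (Store i j) s 1 (set_mem s (reg s i) (reg s j))
| exec_write i s :
    exec B (Write i) s 1 (put s (reg s i))
| exec_seq p1 p2 s1 s2 s3 t1 t2 :
    exec B p1 s1 t1 s2 -> exec B p2 s2 t2 s3 ->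
    exec B (Seq p1 p2) s1 (t1 + t2) s3
| exec_if_true i p1 p2 s t s' : reg s i != 0 ->
    exec B p1 s t s' -> exec B (If i p1 p2) s t.+1 s'
| exec_if_false i p1 p2 s t s' : reg s i = 0 ->
    exec B p2 s t s' -> exec B (If i p1 p2) s t.+1 s'
| exec_while_true i p s1 s2 s3 t1 t2 : reg s1 i != 0 ->
    exec B p s1 t1 s2 -> exec B (While i p) s2 t2 s3 ->
    exec B (While i p) s1 (t1 + t2).+1 s3
| exec_while_false i p s : reg s i = 0 ->
    exec B (While i p) s 1 s.

(* Words of [L * (1 + floor (log2 w))] bits, i.e. of length [O(log w)] for a
   fixed [L]. *)
Definition word_bound (L w : nat) : nat := 2 ^ (L * (trunc_log 2 w).+1).

(** * Input and output conventions *)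

(* Register 0 holds [w], register 1 holds [k], and the memory holds the [w * w]
   adjacency matrix in row-major order; everything else is 0. *)
Definition input (w : nat) (e : rel 'I_w) (k : nat) : state :=
  State (fun i => if i == 0 then w else if i == 1 then k else 0)
        (fun a => [exists i : 'I_w, exists j : 'I_w, (a == i * w + j) && e i j])
        [::].

(* Each set is listed by its elements in increasing order; when all the sets
   have the same known size, no separator is needed between them. *)
Definition listing (w : nat) (l : seq {set 'I_w}) : seq nat :=
  flatten [seq [seq val x | x <- enum (A : {set 'I_w})] | A <- l].

(* The order of the enumeration is free, but every member of [F] is produced
   exactly once. *)
Definition enumerates (w : nat) (F : {set {set 'I_w}}) (o : seq nat) : Prop :=
  exists2 l : seq {set 'I_w}, perm_eq l (enum F) & o = listing l.

(* Main.v *)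
Require Import Defs.
From mathcomp Require Import all_boot zify.

(** Binary partition.  Keep a connected set [I] of included vertices and a set
    [X] of excluded ones, and branch on a candidate: an undecided vertex [v]
    adjacent to [I] (or any undecided vertex if [I] is empty).  Including [v]
    leaves a solution exactly when the component of [v |: I] in the complement
    of [X] has at least [k] vertices, since connected sets can be grown inside
    it one vertex at a time; otherwise [v] is only excluded.  Hence a node of
    the search tree without solutions starts a mere chain of exclusions, and
    with [N] solutions there are [O(N w^2)] nodes, each handled in time
    [O(w^3)].  The search is done in place, with an explicit stack of the
    decided vertices, because the words are too short for [N] or for a list of
    the solutions. *)

Set Implicit Arguments.
Unset Strict Implicit.
Unset Printing Implicit Defensive.

(** * Connected sets *)

Lemma disjointsU1 (V : finType) (v : V) (A B : {set V}) :
  [disjoint v |: A & B] = (v \notin B) && [disjoint A & B].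
Proof. by rewrite !disjoints_subset subUset sub1set inE. Qed.

Section Search.
Variables (V : finType) (e : rel V).
Hypothesis e_sym : symmetric e.
Implicit Types (A D I J K X : {set V}) (x y u v : V) (k : nat).

(** For [J] nonempty, connected and disjoint from [X], this is the connected component around [J] of
    the graph with [X] deleted. Reflexivity of [connect] makes [J] a part of it. *)
Definition component J X : {set V} :=
  [set y | [exists x in J, connect (induced e (~: X)) x y]].

Definition candidate I X v : bool :=
  [&& v \notin I, v \notin X & (I == set0) || [exists u in I, e u v]].

Definition solutions k I X : {set {set V}} :=
  [set A in ksubtrees e k | (I \subset A) && [disjoint A & X]].

Lemma connect_induced_sym D : connect_sym (induced e D).
Proof.
apply: sym_connect_sym => x y; rewrite /induced /=.
by rewrite [e y x]e_sym andbCA.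
Qed.

Lemma connect_induced_sub A D x y :
  A \subset D -> connect (induced e A) x y -> connect (induced e D) x y.
Proof.
move=> sAD; apply: connect_sub => {}x {}y /and3P[xA yA exy].
by apply: connect1; rewrite /induced /= !(subsetP sAD).
Qed.

(** Follow the path up to the first edge that leaves [J]. This supplies a new vertex whenever a
    connected set has to be enlarged. *)
Lemma connect_crossing D J x y :
  connect (induced e D) x y -> x \in J -> y \notin J ->
  exists u v, [/\ u \in J, v \notin J, v \in D & e u v].
Proof.
case/connectP=> p; elim: p x => [|z p IHp] x /=; first by move=> _ -> ->.
case/andP=> /and3P[_ zD exz] pzp yE xJ yNJ.
by have [zJ|zNJ] := boolP (z \in J); [exact: (IHp z) | exists x, z].
Qed.

Lemma component_sub J K X : J \subset K -> component J X \subset component K X.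
Proof.
move=> sJK; apply/subsetP=> y; rewrite !inE => /existsP[x /andP[xJ cxy]].
by apply/existsP; exists x; rewrite (subsetP sJK).
Qed.

Lemma connected_setU1 I v :
  connected_in e I -> (I == set0) || [exists u in I, e u v] ->
  connected_in e (v |: I).
Proof.
move=> cI; case/orP=> [/eqP->|/existsP[u /andP[uI euv]]].
  apply/forall_inP=> x; rewrite setU0 inE => /eqP->.
  by apply/forall_inP=> y; rewrite inE => /eqP->.
have cu z : z \in v |: I -> connect (induced e (v |: I)) u z.
  case/setU1P=> [->|zI]; first by apply: connect1; rewrite /induced /= !inE uI eqxx orbT.
  apply: (connect_induced_sub (subsetUr _ _)).
  exact: (forall_inP (forall_inP cI u uI)).
apply/forall_inP=> x xI; apply/forall_inP=> y yI.
by apply: connect_trans (cu y yI); rewrite connect_induced_sym cu.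
Qed.

(** Greedy growth, by induction on [k - #|J|]: while [J] has fewer than [k] vertices it does not
    exhaust its component, so a path there leaves [J] along some edge, whose endpoint joins [J]. The
    component only grows with [J], so the size hypothesis survives. *)
Lemma connected_extension J X k :
  connected_in e J -> J != set0 -> [disjoint J & X] ->
  #|J| <= k <= #|component J X| -> solutions k J X != set0.
Proof.
move En: (k - #|J|) => n.
elim: n J En => [|n IHn] J kE cJ J0 dJ /andP[leJk lekR].
  apply/set0Pn; exists J; rewrite !inE cJ subxx dJ !andbT.
  by rewrite eqn_leq leJk -subn_eq0 kE.
have /subsetPn[y] : ~~ (component J X \subset J).
  by apply: contraL lekR => /subset_leq_card; lia.
rewrite inE => /existsP[x /andP[xJ cxy]] yNJ.
have [u [v [uJ vNJ vNX euv]]] := connect_crossing cxy xJ yNJ.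
have /set0Pn[A] : solutions k (v |: J) X != set0.
  apply: IHn.
  - by rewrite cardsU1 vNJ; lia.
  - by apply: connected_setU1 => //; apply/orP; right; apply/existsP; exists u; rewrite uJ.
  - by apply/set0Pn; exists v; rewrite setU11.
  - by rewrite disjointsU1 dJ andbT; rewrite inE in vNX.
  rewrite cardsU1 vNJ add1n (leq_trans lekR) ?andbT; first by lia.
  by rewrite subset_leq_card ?component_sub ?subsetUr.
rewrite !inE subUset -!andbA => /and5P[kA cA _ sJA dA].
by apply/set0Pn; exists A; rewrite !inE kA cA sJA.
Qed.

(** * Solutions at a node of the search tree *)

Lemma solutions_full k I X :
  #|I| = k -> connected_in e I -> [disjoint I & X] -> solutions k I X = [set I].
Proof.
move=> Ik cI dI; apply/setP=> A; rewrite !inE.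
apply/idP/eqP=> [/and3P[/andP[/eqP kA _] sIA _]|->].
  by apply/esym/eqP; rewrite eqEcard sIA kA Ik leqnn.
by rewrite Ik eqxx cI subxx.
Qed.

(** A solution [A] is larger than [I], so it has a vertex outside [I]. If [I] is empty, that vertex
    is a candidate; otherwise a path inside [A] from [I] to it leaves [I] at a candidate, [A] being
    disjoint from [X]. *)
Lemma solutions_no_candidate k I X :
  #|I| < k -> (forall v, ~~ candidate I X v) -> solutions k I X = set0.
Proof.
move=> ltIk noC; apply/eqP/set0Pn => -[A].
rewrite !inE => /and3P[/andP[/eqP kA cA] sIA dA].
have AX v : v \in A -> v \notin X by move=> vA; rewrite (disjointFr dA).
have /subsetPn[y yA yNI] : ~~ (A \subset I).
  by apply/negP=> /subset_leq_card; lia.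
have [I0|/set0Pn[x xI]] := eqVneq I set0.
  by move: (noC y); rewrite /candidate yNI AX // I0 eqxx.
have cxy := forall_inP (forall_inP cA x (subsetP sIA x xI)) y yA.
have [u [v [uI vNI vA euv]]] := connect_crossing cxy xI yNI.
move: (noC v); rewrite /candidate vNI AX //=; case/norP=> _ /existsP[].
by exists u; rewrite uI.
Qed.

Lemma solutions_split k I X v :
  solutions k I X = solutions k (v |: I) X :|: solutions k I (v |: X).
Proof.
apply/setP=> A; rewrite !inE subUset sub1set [[disjoint A & v |: X]]disjoint_sym.
rewrite disjointsU1 [[disjoint X & A]]disjoint_sym.
by case: (v \in A); rewrite /= ?andbF ?orbF.
Qed.

Lemma disjoint_solutions k I X v :
  [disjoint solutions k (v |: I) X & solutions k I (v |: X)].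
Proof.
rewrite disjoint_subset; apply/subsetP=> A; rewrite !inE subUset sub1set.
case/and3P=> _ /andP[vA _] _.
by rewrite [[disjoint A & v |: X]]disjoint_sym disjointsU1 vA !andbF.
Qed.

(** A connected [A] that contains [v] and avoids [X] stays inside the component, which has no room
    for [k] vertices. *)
Lemma solutions_small_component k I X v :
  #|component (v |: I) X| < k -> solutions k (v |: I) X = set0.
Proof.
move=> ltRk; apply/eqP/set0Pn => -[A]; rewrite !inE subUset sub1set.
case/and3P=> /andP[/eqP kA cA] /andP[vA _] dA.
suff /subset_leq_card : A \subset component (v |: I) X by lia.
apply/subsetP=> y yA; rewrite inE; apply/existsP; exists v; rewrite setU11 /=.
apply: (@connect_induced_sub A); last exact: (forall_inP (forall_inP cA v vA)).
by rewrite -disjoints_subset.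
Qed.

(** Every inclusion branch that passes the size test therefore contains a solution, to which its
    cost can be charged. *)
Lemma solutions_large_component k I X v :
  connected_in e I -> [disjoint I & X] -> candidate I X v -> #|I| < k ->
  k <= #|component (v |: I) X| -> solutions k (v |: I) X != set0.
Proof.
move=> cI dI /and3P[vNI vNX adj] ltIk lekR.
apply: connected_extension; first exact: connected_setU1.
- by apply/set0Pn; exists v; rewrite setU11.
- by rewrite disjointsU1 vNX.
- by rewrite cardsU1 vNI add1n ltIk.
Qed.

Lemma solutions_top k : solutions k set0 set0 = ksubtrees e k.
Proof. by apply/setP=> A; rewrite !inE sub0set disjoints_subset setC0 subsetT !andbT. Qed.

(** Connectivity makes the component of a single vertex the whole graph, so the vertex extends to
    [k] elements. A positive number of subtrees lets the time bound absorb the costs paid in every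
    run, such as initialisation. *)
Lemma ksubtrees_neq0 k :
  connected_in e [set: V] -> 0 < k <= #|V| -> ksubtrees e k != set0.
Proof.
move=> cV /andP[k0 kV].
have /card_gt0P[x _] : 0 < #|V| by apply: leq_trans kV.
have full : component [set x] set0 = [set: V].
  apply/setP=> y; rewrite !inE; apply/existsP; exists x.
  by rewrite set11 setC0 /=; apply: (forall_inP (forall_inP cV x _)); rewrite inE.
have /set0Pn[A] : solutions k [set x] set0 != set0.
  apply: connected_extension.
  - have := @connected_setU1 set0 x; rewrite setU0 eqxx; apply=> //.
    by apply/forall_inP=> y; rewrite inE.
  - by apply/set0Pn; exists x; rewrite set11.
  - by rewrite disjoints_subset setC0 subsetT.
  - by rewrite cards1 k0 full cardsT.
by rewrite !inE => /andP[kA _]; apply/set0Pn; exists A; rewrite inE.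
Qed.

End Search.

(** * The program *)

(* Every loop other than the main one runs at most [w] times. *)
Fixpoint cost (w : nat) (p : prog) : nat :=
  match p with
  | Seq p q => cost w p + cost w q
  | If _ p q => (cost w p + cost w q).+1
  | While _ p => (w * (cost w p).+1).+1
  | _ => 1
  end.

Declare Scope prog_scope.
Notation "p ;; q" := (Seq p q) (at level 90, right associativity) : prog_scope.
Local Open Scope prog_scope.

(* Registers: 2 holds 1; 3, 4, 5 and 6 hold the addresses of the indicator
   arrays of [I] and of [X], of the stack, and of the component being computed;
   7 is the size of the stack, 8 is [#|I|], 9 is nonzero until the search ends,
   10 is nonzero when a new node is entered and zero when backtracking; 11 to
   16 are loop counters, 17 the branching vertex, 18 to 20 temporaries. *)
Definition For (i : nat) (p : prog) : prog :=
  Assign i (Cst 0);; Assign i.+1 (Defs.Sub 0 i);;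
  While i.+1 (p;; Assign i (Add i 2);; Assign i.+1 (Defs.Sub 0 i)).

Definition GetBit (x b i : nat) : prog := Assign x (Add b i);; Assign x (Read x).

Definition GetEdge (x i j : nat) : prog :=
  Assign x (Mul i 0);; Assign x (Add x j);; Assign x (Read x).

Definition PutBit (b i y : nat) : prog := Assign 20 (Add b i);; Store 20 y.

(** There is no early exit: a later candidate overwrites an earlier one, since any of them may serve
    as branching vertex. [Mul 13 2] copies register 13, register 2 being 1. *)
Definition Find : prog :=
  Assign 18 (Cst 0);;
  For 11 (For 13 (
    GetBit 19 3 13;;
    If 19 Skip (
      GetBit 19 4 13;;
      If 19 Skip (
        If 8 (GetBit 19 3 11;; If 19 (GetEdge 19 11 13) Skip)
             (Assign 19 (Cst 1));;
        If 19 (Assign 17 (Mul 13 2);; Assign 18 (Cst 1)) Skip)))).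

Definition Relax : prog :=
  GetBit 19 6 13;;
  If 19 (
    GetEdge 19 13 15;;
    If 19 (GetBit 19 4 15;; If 19 Skip (PutBit 6 15 2)) Skip)
  Skip.

(** Rounds of relaxation over all ordered pairs, in the manner of Bellman and Ford. This triple loop
    is what makes a node cost [O(w^3)]. *)
Definition Reach : prog :=
  For 11 (GetBit 19 3 11;; PutBit 6 11 19);;
  PutBit 6 17 2;;
  For 11 (For 13 (For 15 Relax)).

Definition Count : prog :=
  Assign 18 (Cst 0);;
  For 11 (GetBit 19 6 11;; Assign 18 (Add 18 19)).

Definition Output : prog := For 11 (GetBit 19 3 11;; If 19 (Write 11) Skip).

(** Truncated subtraction serves as comparison: [k - #|I|] is nonzero when vertices are still
    missing, and [k] minus the size of the component is nonzero when including the candidate is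
    hopeless. *)
Definition Forward : prog :=
  Assign 19 (Defs.Sub 1 8);;
  If 19 (
    Find;;
    If 18 (
      Reach;; Count;;
      Assign 19 (Defs.Sub 1 18);;
      If 19 (PutBit 4 17 2) (PutBit 3 17 2;; Assign 8 (Add 8 2));;
      PutBit 5 7 17;;
      Assign 7 (Add 7 2))
    (Assign 10 (Cst 0)))
  (Output;; Assign 10 (Cst 0)).

(** Membership of the popped vertex in [I] tells which branch has ended, so the stack stores no
    branch marker. After an inclusion the vertex moves to [X] and is pushed back by raising the
    stack size alone, its cell being intact; after an exclusion it becomes undecided again. *)
Definition Flip : prog :=
  If 19 (
    PutBit 3 17 18;;
    Assign 8 (Defs.Sub 8 2);;
    PutBit 4 17 2;;
    Assign 7 (Add 7 2);;
    Assign 10 (Cst 1))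
  (PutBit 4 17 18).

Definition Backward : prog :=
  If 7 (
    Assign 7 (Defs.Sub 7 2);;
    GetBit 17 5 7;;
    GetBit 19 3 17;;
    Assign 18 (Cst 0);;
    Flip)
  (Assign 9 (Cst 0)).

Definition Body : prog := If 10 Forward Backward.

Definition Init : prog :=
  Assign 2 (Cst 1);;
  Assign 3 (Mul 0 0);;
  Assign 4 (Add 3 0);;
  Assign 5 (Add 4 0);;
  Assign 6 (Add 5 0);;
  Assign 9 (Cst 1);;
  Assign 10 (Cst 1).

Definition Enumerate : prog := Init;; While 9 Body.

(** * Correctness and running time *)

Section Machine.
Variables (B w k : nat) (e : rel 'I_w).
Hypothesis B_large : w * w + 4 * w < B.
Hypothesis w_gt0 : 0 < w.
Hypothesis k_le_w : k <= w.
Implicit Types (I X J S : {set 'I_w}) (s : state) (p q : prog).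

(** A weakest precondition with termination. The time bound depends on [p] and [w] alone, which
    keeps time out of the postconditions. The main loop, whose passes are not bounded by [w], is
    treated separately. *)
Definition runs p s (Q : state -> Prop) : Prop :=
  exists t s', [/\ exec B p s t s', t <= cost w p & Q s'].

Lemma runs_weaken p s (Q Q' : state -> Prop) :
  runs p s Q -> (forall s', Q s' -> Q' s') -> runs p s Q'.
Proof. by move=> [t [s' [ex le /[swap] QQ' /QQ' ?]]]; exists t, s'. Qed.

Lemma runs_skip s (Q : state -> Prop) : Q s -> runs Skip s Q.
Proof. by exists 1, s; split=> //; constructor. Qed.

Lemma runs_set i ex v s (Q : state -> Prop) :
  eval ex s = v -> v < B -> Q (set_reg s i v) -> runs (Assign i ex) s Q.
Proof. by move=> <- lt Qs; exists 1, (set_reg s i (eval ex s)); split=> //; constructor. Qed.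

Lemma runs_store i j a b s (Q : state -> Prop) :
  reg s i = a -> reg s j = b -> Q (set_mem s a b) -> runs (Store i j) s Q.
Proof.
by move=> <- <- Qs; exists 1, (set_mem s (reg s i) (reg s j)); split=> //; constructor.
Qed.

Lemma runs_write i s (Q : state -> Prop) : Q (put s (reg s i)) -> runs (Write i) s Q.
Proof. by exists 1, (put s (reg s i)); split=> //; constructor. Qed.

Lemma runs_seq p q s (Q : state -> Prop) :
  runs p s (fun s' => runs q s' Q) -> runs (p;; q) s Q.
Proof.
move=> [t1 [s1 [ex1 le1 [t2 [s2 [ex2 le2 Qs]]]]]]; exists (t1 + t2), s2.
by split=> //; [exact: exec_seq ex1 ex2 | exact: leq_add].
Qed.

Lemma runs_if i p q s (Q : state -> Prop) :
  (reg s i <> 0 -> runs p s Q) -> (reg s i = 0 -> runs q s Q) -> runs (If i p q) s Q.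
Proof.
have [r0 _ /(_ r0)|/eqP r0 /(_ r0) + _] := eqVneq (reg s i) 0.
- move=> [t [s' [ex le Qs]]]; exists t.+1, s'; split=> //=; last by lia.
  exact: exec_if_false.
- move=> [t [s' [ex le Qs]]]; exists t.+1, s'; split=> //=; last by lia.
  by apply: exec_if_true => //; apply/eqP.
Qed.

(** * Memory layout, reserved registers and counting loops *)

Definition base_in : nat := w * w.
Definition base_ex : nat := w * w + w.
Definition base_stack : nat := w * w + w + w.
Definition base_reach : nat := w * w + w + w + w.

(** Registers 0 to 10 during the search: only the stack size [d], the number [z] of included
    vertices and the direction [f] vary. *)
Definition frame_regs (d z f : nat) : seq nat :=
  [:: w; k; 1; base_in; base_ex; base_stack; base_reach; d; z; 1; f].

Definition frame (d z f : nat) s : Prop :=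
  [seq reg s i | i <- iota 0 11] = frame_regs d z f.

Lemma frameE d z f s : frame d z f s ->
  (reg s 0 = w) * (reg s 1 = k) * (reg s 2 = 1) * (reg s 3 = base_in) *
  (reg s 4 = base_ex) * (reg s 5 = base_stack) * (reg s 6 = base_reach) *
  (reg s 7 = d) * (reg s 8 = z) * (reg s 9 = 1) * (reg s 10 = f).
Proof. by case. Qed.

Definition agree (n : nat) s s' : Prop :=
  [/\ forall r, r < n -> reg s' r = reg s r, memory s' = memory s & out s' = out s].

Lemma frame_eq d z f s s' :
  (forall r, r < 11 -> reg s' r = reg s r) -> frame d z f s -> frame d z f s'.
Proof.
move=> rr fr; rewrite /frame -fr; apply/eq_in_map => r.
by rewrite mem_iota => /andP[_ r11]; apply: rr.
Qed.

Lemma agree_frame n d z f s s' : 10 < n -> agree n s s' -> frame d z f s -> frame d z f s'.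
Proof. by move=> n10 [ag _ _]; apply: frame_eq => r lt; apply: ag; lia. Qed.

Lemma agree_trans n s1 s2 s3 : agree n s1 s2 -> agree n s2 s3 -> agree n s1 s3.
Proof.
move=> [r12 m12 o12] [r23 m23 o23]; split; rewrite ?m23 ?o23 //.
by move=> r lt; rewrite r23 ?r12.
Qed.

Lemma agree_set i s v : agree i s (set_reg s i v).
Proof. by split=> // r lt /=; rewrite ltn_eqF. Qed.

Lemma runs_assign i ex v s (Q : state -> Prop) :
  eval ex s = v -> v < B -> (forall s', agree i s s' -> reg s' i = v -> Q s') ->
  runs (Assign i ex) s Q.
Proof.
move=> ev lt QQ; apply: (runs_set ev lt); apply: QQ; first exact: agree_set.
by rewrite /= eqxx.
Qed.

Lemma frame_loop d z f i s a b :
  10 < i -> frame d z f s -> frame d z f (set_reg (set_reg s i a) i.+1 b).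
Proof.
move=> i10; apply: (agree_frame i10); apply: agree_trans (agree_set _ _ _) _.
by split=> // r lt /=; rewrite ltn_eqF // ltnW.
Qed.

(** [Inv] must not depend on the two loop registers, which change between passes. The body has to
    preserve the counter but may spoil register [i.+1], which is recomputed. *)
Lemma runs_for d z f (Inv : nat -> state -> Prop) i p s (Q : state -> Prop) :
  10 < i -> frame d z f s ->
  (forall n s a b, Inv n s -> Inv n (set_reg (set_reg s i a) i.+1 b)) ->
  Inv 0 s ->
  (forall (v : 'I_w) s, frame d z f s -> Inv v s -> reg s i = v ->
     runs p s (fun s' => [/\ frame d z f s', Inv v.+1 s' & reg s' i = v])) ->
  (forall s', frame d z f s' -> Inv w s' -> Q s') ->
  runs (For i p) s Q.
Proof.
move=> i10 fr stable inv0 body post.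
have reset s1 n : frame d z f s1 -> Inv n s1 -> n <= w ->
    let s2 := set_reg (set_reg s1 i n) i.+1 (w - n) in
    [/\ frame d z f s2, Inv n s2, reg s2 i = n & reg s2 i.+1 = w - n].
  move=> fr1 inv1 len s2; split; [exact: frame_loop|exact: stable| |].
    by rewrite /= eqn_leq ltnn andbF eqxx.
  by rewrite /= eqxx.
have sub_reset s1 n : frame d z f s1 ->
    eval (Defs.Sub 0 i) (set_reg s1 i n) = w - n.
  by move=> fr1 /=; rewrite eqxx ltn_eqF ?(ltn_trans _ i10) // (frameE fr1).
(* [m] passes remain, as register [i.+1] shows. The three extra units per pass are the loop test and
   the two counter updates. *)
have loop m : forall n s1, n + m = w -> frame d z f s1 -> Inv n s1 ->
    reg s1 i = n -> reg s1 i.+1 = m ->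
    exists t s2, [/\ exec B (While i.+1 (p;; Assign i (Add i 2);; Assign i.+1 (Defs.Sub 0 i))) s1 t s2,
      t <= (m * (cost w p).+3).+1, frame d z f s2 & Inv w s2].
  elim: m => [|m IHm] n s1 nm fr1 inv1 ri rt.
    exists 1, s1; split; [exact: exec_while_false|by []|by []|].
    by rewrite -nm addn0.
  have ltnw : n < w by lia.
  have [t1 [s2 [ex1 le1 [fr2 inv2 ri2]]]] := body (Ordinal ltnw) s1 fr1 inv1 ri.
  have [fr3 inv3 ri3 rt3] := reset s2 n.+1 fr2 inv2 ltnw.
  have nm' : n.+1 + m = w by lia.
  have rt3' : w - n.+1 = m by lia.
  rewrite rt3' in fr3 inv3 ri3 rt3.
  have [t2 [s4 [ex2 le2 fr4 inv4]]] := IHm _ _ nm' fr3 inv3 ri3 rt3.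
  exists (t1 + (1 + 1) + t2).+1, s4; split=> //; last by rewrite mulSn; lia.
  apply: exec_while_true ex2; first by rewrite rt.
  apply: exec_seq ex1 _; apply: (@exec_seq _ _ _ _ (set_reg s2 i n.+1)).
    have -> : n.+1 = eval (Add i 2) s2 by rewrite /= ri2 (frameE fr2) ?addn1.
    by constructor; rewrite /= ri2 (frameE fr2) //=; nia.
  by rewrite -rt3' -(sub_reset _ n.+1 fr2); constructor; rewrite sub_reset //; nia.
apply: runs_seq; apply: (@runs_set _ _ 0) => //; first by lia.
apply: runs_seq; apply: (@runs_set _ _ w); rewrite ?sub_reset ?subn0 //; first by nia.
have [] := reset s 0 fr inv0 (leq0n _); rewrite subn0 => fr1 inv1 ri rt.
have [t [s2 [ex le fr2 inv2]]] := loop w 0 _ (add0n _) fr1 inv1 ri rt.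
exists t, s2; split=> //=; last exact: post.
by rewrite !addn1 addn2; exact: le.
Qed.

(** * Sets, adjacency matrix and stack in memory *)

Definition bits (m : nat -> nat) (b : nat) (A : {set 'I_w}) : Prop :=
  forall v : 'I_w, m (b + v) = (v \in A).

Definition adjacency (m : nat -> nat) : Prop :=
  forall u v : 'I_w, m (u * w + v) = e u v.

Definition stacked (m : nat -> nat) (stk : seq 'I_w) : Prop :=
  forall j, j < size stk -> m (base_stack + j) = nth 0 (map val stk) j.

(** The array at [base_reach] is left out: its content matters only while one component is computed
    and counted. *)
Definition stored (m : nat -> nat) (stk : seq 'I_w) I X : Prop :=
  [/\ adjacency m, bits m base_in I, bits m base_ex X, stacked m stk & size stk <= w].

Lemma bits_add m b A (v : 'I_w) : bits m b A -> bits [eta m with b + v |-> 1] b (v |: A).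
Proof. by move=> mA u /=; rewrite eqn_add2l val_eqE !inE; case: eqP. Qed.

Lemma bits_remove m b A (v : 'I_w) : bits m b A -> bits [eta m with b + v |-> 0] b (A :\ v).
Proof. by move=> mA u /=; rewrite eqn_add2l val_eqE !inE; case: eqP. Qed.

Lemma bits_other m b A a x :
  a < b \/ b + w <= a -> bits m b A -> bits [eta m with a |-> x] b A.
Proof.
move=> ab mA u /=; case: eqP => // E; have := ltn_ord u; lia.
Qed.

Lemma adjacency_other m a x :
  w * w <= a -> adjacency m -> adjacency [eta m with a |-> x].
Proof.
move=> ab mA u v /=; case: eqP => // E; have := ltn_ord u; have := ltn_ord v; nia.
Qed.

Lemma stacked_other m stk a x :
  a < base_stack \/ base_stack + size stk <= a -> stacked m stk ->
  stacked [eta m with a |-> x] stk.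
Proof. by move=> ab mS j lt /=; case: eqP => [E|_]; [lia | exact: mS]. Qed.

Lemma stored_reach m stk I X (v : 'I_w) x :
  stored m stk I X -> stored [eta m with base_reach + v |-> x] stk I X.
Proof.
rewrite /base_reach => -[mE mI mX mS szw]; split=> //.
- by apply: adjacency_other => //; lia.
- by apply: bits_other => //; rewrite /base_in; lia.
- by apply: bits_other => //; rewrite /base_ex; lia.
- by apply: stacked_other => //; rewrite /base_stack; lia.
Qed.

(** * Access to single array entries *)

Lemma runs_GetBit x b i a A (v : 'I_w) s (Q : state -> Prop) :
  bits (memory s) a A -> reg s b = a -> reg s i = v -> a <= base_reach ->
  (forall s', agree x s s' -> reg s' x = (v \in A) -> Q s') ->
  runs (GetBit x b i) s Q.
Proof.
rewrite /base_reach => mA rb ri la QQ.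
apply: runs_seq; apply: (@runs_assign _ _ (a + v)); rewrite /= ?rb ?ri //.
  by have := ltn_ord v; lia.
move=> s1 ag1 r1; apply: (@runs_assign _ _ (v \in A)).
- by have [_ mm _] := ag1; rewrite /= r1 mm mA.
- by case: (_ \in _); lia.
by move=> s2 ag2 r2; apply: QQ r2; apply: agree_trans ag1 ag2.
Qed.

Lemma runs_GetEdge d z f x i j (u v : 'I_w) s (Q : state -> Prop) :
  frame d z f s -> adjacency (memory s) -> reg s i = u -> reg s j = v -> j < x ->
  (forall s', agree x s s' -> reg s' x = e u v -> Q s') ->
  runs (GetEdge x i j) s Q.
Proof.
move=> fr mE ri rj ltjx QQ; have ltu := ltn_ord u; have ltv := ltn_ord v.
apply: runs_seq; apply: (@runs_assign _ _ (u * w)); rewrite /= ?ri ?(frameE fr) //.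
  by nia.
move=> s1 ag1 r1; apply: runs_seq; apply: (@runs_assign _ _ (u * w + v)) => //=.
- by have [ag _ _] := ag1; rewrite r1 ag // rj.
- by nia.
move=> s2 ag2 r2; have ag12 := agree_trans ag1 ag2.
apply: (@runs_assign _ _ (e u v)).
- by have [_ mm _] := ag12; rewrite /= r2 mm mE.
- by case: (e u v); lia.
by move=> s3 ag3 r3; apply: QQ r3; apply: agree_trans ag12 ag3.
Qed.

Lemma runs_PutBit b i y a x (n : nat) s (Q : state -> Prop) :
  reg s b = a -> reg s i = n -> reg s y = x -> y < 20 -> a <= base_reach -> n < w ->
  (forall s', [/\ forall r, r < 20 -> reg s' r = reg s r, out s' = out s
    & memory s' = [eta memory s with a + n |-> x]] -> Q s') ->
  runs (PutBit b i y) s Q.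
Proof.
rewrite /base_reach => rb ri ry y20 la ltv QQ.
apply: runs_seq; apply: (@runs_assign _ _ (a + n)); rewrite /= ?rb ?ri //.
  by lia.
move=> s1 [ag1 mm1 oo1] r1; apply: (@runs_store _ _ (a + n) x) => //; first by rewrite ag1.
by apply: QQ; split; rewrite //= mm1.
Qed.

(** * Search for a branching vertex *)

Definition linked I (u v : 'I_w) : bool := (I == set0) || (u \in I) && e u v.

Lemma candidate_linked I X v :
  candidate e I X v = [&& v \notin I, v \notin X & [exists u, linked I u v]].
Proof.
rewrite /candidate; congr [&& _, _ & _]; apply/idP/existsP.
  case/orP=> [I0|/existsP[u uP]]; first by exists v; rewrite /linked I0.
  by exists u; rewrite /linked uP orbT.
by case=> u /orP[->//|uP]; apply/orP; right; apply/existsP; exists u.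
Qed.

(** [P] describes the pairs examined so far. A found vertex is only required to be a candidate, so
    overwriting it by another one preserves the invariant. *)
Definition searched I X m o (P : 'I_w -> 'I_w -> Prop) s : Prop :=
  [/\ memory s = m, out s = o &
    reg s 18 = 0 /\ (forall u v, P u v -> ~~ [&& v \notin I, v \notin X & linked I u v])
    \/ reg s 18 = 1 /\ exists2 v : 'I_w, reg s 17 = v & candidate e I X v].

Lemma searched_weaken I X m o (P P' : 'I_w -> 'I_w -> Prop) s :
  searched I X m o P s -> (forall u v, P' u v -> P u v) -> searched I X m o P' s.
Proof.
move=> [mm oo [[r18 no]|found]] sub; split=> //; [left|by right].
by split=> // u v /sub; exact: no.
Qed.

Lemma runs_Find d f stk I X s (Q : state -> Prop) :
  frame d #|I| f s -> stored (memory s) stk I X ->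
  (forall s', frame d #|I| f s' -> memory s' = memory s -> out s' = out s ->
     reg s' 18 = 0 /\ (forall v, ~~ candidate e I X v) \/
     reg s' 18 = 1 /\ (exists2 v : 'I_w, reg s' 17 = v & candidate e I X v) -> Q s') ->
  runs Find s Q.
Proof.
move=> fr st QQ; have [mE mI mX _ _] := st.
apply: runs_seq; apply: (@runs_set _ _ 0) => //; first by lia.
pose Inv n s1 := searched I X (memory s) (out s) (fun u _ => u < n) s1.
apply: (@runs_for d #|I| f Inv) => //; first by split=> //; left.
  move=> u s1 fr1 inv1 r11.
  pose Inv' n s2 := reg s2 11 = u /\
    searched I X (memory s) (out s) (fun u' v => u' < u \/ u' = u /\ v < n) s2.
  apply: (@runs_for d #|I| f Inv') => //.
  - by split=> //; apply: searched_weaken inv1 _ => u' v [|[]].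
  - move=> v s2 fr2 [r11' inv2] r13.
    (* Covers all exits without a discovery: the examined pairs, in lexicographic order, gain
       [(u, v)]. *)
    have extend s3 : agree 19 s2 s3 ->
        ~~ [&& v \notin I, v \notin X & linked I u v] ->
        [/\ frame d #|I| f s3, Inv' v.+1 s3 & reg s3 13 = v].
      move=> ag nouv; have [rr mm oo] := ag; have [m2 o2 srch] := inv2.
      split; [exact: (agree_frame (n := 19) isT ag fr2)| |by rewrite rr].
      split; first by rewrite rr.
      split; rewrite ?mm ?oo // !rr //.
      case: srch => [[r18 no]|?]; [left; split=> // u' v' uv'|by right].
      have [/andP[/eqP-> /eqP->] //|ne] := boolP ((u' == u) && (v' == v)).
      apply: no; case: uv' => [|[uu lt]]; [by left|right; split=> //].
      by move: ne; rewrite uu eqxx -val_eqE /=; lia.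
    have [m2 o2 srch] := inv2.
    apply: runs_seq; apply: (@runs_GetBit _ _ _ base_in I v) => //;
      rewrite ?m2 ?(frameE fr2) // /base_in /base_reach; first by lia.
    move=> s3 ag3 r3; apply: runs_if => [|r0].
      by rewrite r3; case: (boolP (v \in I)) => // vI _; apply: runs_skip; apply: extend; rewrite ?vI.
    have vNI : v \notin I by move: r0; rewrite r3; case: (v \in I).
    have fr3 := agree_frame (n := 19) isT ag3 fr2; have [rr3 mm3 oo3] := ag3.
    apply: runs_seq; apply: (@runs_GetBit _ _ _ base_ex X v) => //;
      rewrite ?mm3 ?m2 ?(frameE fr3) ?rr3 // /base_ex /base_reach; first by lia.
    move=> s4 /(agree_trans ag3) ag4 r4; apply: runs_if => [|r0'].
      rewrite r4; case: (boolP (v \in X)) => // vX _; apply: runs_skip; apply: extend => //.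
      by rewrite vX andbF.
    have vNX : v \notin X by move: r0'; rewrite r4; case: (v \in X).
    have fr4 := agree_frame (n := 19) isT ag4 fr2; have [rr4 mm4 oo4] := ag4.
    apply: runs_seq.
    (* Register 19 is set in three ways: by the edge test, by failure of the membership test, or to
       1 when [I] is empty. The closing test is verified once for all three. *)
    suff final s5 : agree 19 s2 s5 -> reg s5 19 = linked I u v ->
        runs (If 19 (Assign 17 (Mul 13 2);; Assign 18 (Cst 1)) Skip) s5
          (fun s' => [/\ frame d #|I| f s', Inv' v.+1 s' & reg s' 13 = v]).
      apply: runs_if => [|r8].
        rewrite (frameE fr4) //= => /eqP; rewrite cards_eq0 => I0.
        apply: runs_seq; apply: (@runs_GetBit _ _ _ base_in I u) => //;
          rewrite ?mm4 ?m2 ?(frameE fr4) ?rr4 // /base_in /base_reach; first by lia.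
        move=> s5 /(agree_trans ag4) ag5 r5; have [rr5 mm5 oo5] := ag5.
        apply: runs_if => [|r19].
          rewrite r5; case: (boolP (u \in I)) => // uI _.
          apply: (@runs_GetEdge d #|I| f _ _ _ u v) => //; rewrite ?mm5 ?m2 ?rr5 //.
            exact: (agree_frame (n := 19) isT ag5 fr2).
          move=> s6 /(agree_trans ag5) ag6 r6; apply: final => //.
          by rewrite r6 /linked (negPf I0) uI.
        apply: runs_skip; apply: final => //.
        by move: r19; rewrite r5 /linked (negPf I0); case: (u \in I).
      apply: (@runs_assign _ _ 1) => //; first by lia.
      move=> s5 /(agree_trans ag4) ag5 r5; apply: final => //.
      move/eqP: r8; rewrite (frameE fr4) //= cards_eq0 => I0.
      by rewrite r5 /linked I0.
    move=> ag5 r5; have [rr5 mm5 oo5] := ag5; have fr5 := agree_frame (n := 19) isT ag5 fr2.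
    apply: runs_if => [|r19]; last first.
      apply: runs_skip; apply: extend => //.
      by move: r19; rewrite r5 vNI vNX; case: (linked _ _ _).
    rewrite r5; case lk : (linked I u v) => // _.
    apply: runs_seq; apply: (@runs_set _ _ v) => //=.
    - by rewrite rr5 // r13 (frameE fr5) //= muln1.
    - by have := ltn_ord v; nia.
    apply: (@runs_set _ _ 1) => //; first by lia.
    split; [exact: fr5| |by rewrite /= rr5].
    split; first by rewrite /= rr5.
    split; rewrite /= ?mm5 ?oo5 //; right; split=> //; exists v => //.
    by rewrite candidate_linked vNI vNX; apply/existsP; exists u.
  - move=> s2 fr2 [r11' inv2]; split=> //.
    apply: searched_weaken inv2 _ => u' v; rewrite ltnS leq_eqVlt => /orP[/eqP/val_inj->|]; last by left.
    by right; split.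
move=> s1 fr1 [m1 o1 srch]; apply: QQ => //.
case: srch => [[r18 no]|?]; [left; split=> // v|by right].
rewrite candidate_linked; apply/negP=> /and3P[vNI vNX /existsP[u lk]].
by move: (no u v (ltn_ord u)); rewrite vNI vNX lk.
Qed.

(** * Computing a component by relaxation *)

Section Reaching.
Variables (d z f : nat) (stk : seq 'I_w) (I X : {set 'I_w}) (v : 'I_w) (o : seq nat).
Let T := component e (v |: I) X.

(** [S0] is the marked set at the start of a round, [S] the current one, and [P] describes the pairs
    relaxed in the round. Closure is asked only for [u] in [S0], so marks added during the round do
    no harm. *)
Definition grown S0 (P : 'I_w -> 'I_w -> Prop) s : Prop :=
  [/\ stored (memory s) stk I X, out s = o, reg s 17 = v &
    exists S, [/\ bits (memory s) base_reach S, S0 \subset S, S \subset T,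
      [disjoint S & X] &
      forall u y, P u y -> u \in S0 -> e u y -> y \notin X -> y \in S]].

Lemma grown_weaken S0 (P P' : 'I_w -> 'I_w -> Prop) s :
  grown S0 P s -> (forall u y, P' u y -> P u y) -> grown S0 P' s.
Proof.
move=> [st oo r17 [S [mS S0S ST dS closed]]] sub; split=> //; exists S; split=> //.
by move=> u y /sub; exact: closed.
Qed.

Lemma runs_Relax S0 (P P' : 'I_w -> 'I_w -> Prop) (n u y : 'I_w) s (Q : state -> Prop) :
  frame d z f s -> grown S0 P s -> reg s 11 = n -> reg s 13 = u -> reg s 15 = y ->
  (forall u' y', P' u' y' -> P u' y' \/ u' = u /\ y' = y) ->
  (forall s', frame d z f s' -> grown S0 P' s' -> reg s' 11 = n -> reg s' 13 = u ->
     reg s' 15 = y -> Q s') ->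
  runs Relax s Q.
Proof.
move=> fr [st oo r17 [S [mS S0S ST dS closed]]] r11 r13 r15 PP' QQ.
have [mE mI mX mstk szstk] := st.
have idle s' : agree 19 s s' -> ~~ [&& u \in S, e u y & y \notin X] -> Q s'.
  move=> ag nouy; have [rr mm o'] := ag.
  apply: QQ; rewrite ?rr //; first exact: (agree_frame (n := 19) isT ag fr).
  split; rewrite ?mm ?o' ?rr //; exists S; split=> // u' y' /PP'[|[-> ->]].
    exact: closed.
  by move=> /(subsetP S0S) uS euy yNX; rewrite uS euy yNX in nouy.
apply: runs_seq; apply: (@runs_GetBit _ _ _ base_reach S u) => //; rewrite ?(frameE fr) //.
move=> s1 ag1 r1; apply: runs_if => [|r0]; last first.
  apply: runs_skip; apply: idle => //.
  by move: r0; rewrite r1; case: (u \in S).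
rewrite r1; case: (boolP (u \in S)) => // uS _.
have fr1 := agree_frame (n := 19) isT ag1 fr; have [rr1 mm1 oo1] := ag1.
apply: runs_seq; apply: (@runs_GetEdge d z f _ _ _ u y) => //; rewrite ?mm1 ?rr1 //.
move=> s2 /(agree_trans ag1) ag2 r2; apply: runs_if => [|r0]; last first.
  apply: runs_skip; apply: idle => //.
  by move: r0; rewrite r2 uS; case: (e u y).
rewrite r2; case euy : (e u y) => // _.
have fr2 := agree_frame (n := 19) isT ag2 fr; have [rr2 mm2 oo2] := ag2.
apply: runs_seq; apply: (@runs_GetBit _ _ _ base_ex X y) => //;
  rewrite ?mm2 ?(frameE fr2) ?rr2 // /base_ex /base_reach; first by lia.
move=> s3 /(agree_trans ag2) ag3 r3; apply: runs_if => [|r0].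
  rewrite r3; case: (boolP (y \in X)) => // yX _.
  by apply: runs_skip; apply: idle => //; rewrite yX !andbF.
have yNX : y \notin X by move: r0; rewrite r3; case: (y \in X).
have fr3 := agree_frame (n := 19) isT ag3 fr; have [rr3 mm3 oo3] := ag3.
apply: (@runs_PutBit _ _ _ base_reach 1 y) => //; rewrite ?(frameE fr3) ?rr3 //.
move=> s4 [rr4 oo4 mm4].
have rr r : r < 19 -> reg s4 r = reg s r by move=> lt; rewrite rr4 ?rr3 //; lia.
apply: QQ; rewrite ?rr //.
  by apply: frame_eq fr => r ?; apply: rr; lia.
split; rewrite ?mm4 ?mm3 ?oo4 ?oo3 ?rr //; first exact: stored_reach.
exists (y |: S); split; first exact: bits_add.
- by rewrite (subset_trans S0S) ?subsetUr.
(* A path to [u] inside the component extends by the edge to [y]; [u] avoids [X] because [S]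
   does. *)
- rewrite subUset ST andbT sub1set.
  have := subsetP ST u uS; rewrite !inE => /existsP[x /andP[xJ cxu]].
  apply/existsP; exists x; rewrite xJ; apply: connect_trans cxu (connect1 _).
  by rewrite /induced /= !inE (disjointFr dS uS) yNX euy.
- by rewrite disjointsU1 yNX.
move=> u' y' /PP'[Puy u'S eu'y' y'NX|[_ ->] _ _ _]; last exact: setU11.
by rewrite setU1r ?(closed u').
Qed.

Definition deep (n : nat) S : Prop :=
  forall x (p : seq 'I_w), x \in v |: I -> path (induced e (~: X)) x p -> size p <= n -> last x p \in S.

(** A walk can be shortened to a duplicate-free one, which has fewer than [w] edges, so [w] rounds
    reach the whole component. *)
Lemma deep_component S : deep w S -> T \subset S.
Proof.
move=> dS; apply/subsetP=> y; rewrite inE => /existsP[x /andP[xJ /connectP[p pth ->]]].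
case/shortenP: pth => p' pth' un _; apply: dS => //.
by have := max_card (mem (x :: p')); rewrite (card_uniqP un) card_ord /=; lia.
Qed.

Lemma runs_Reach s (Q : state -> Prop) :
  frame d z f s -> stored (memory s) stk I X -> out s = o -> reg s 17 = v ->
  [disjoint v |: I & X] ->
  (forall s', frame d z f s' -> stored (memory s') stk I X -> out s' = o ->
     reg s' 17 = v -> bits (memory s') base_reach T -> Q s') ->
  runs Reach s Q.
Proof.
move=> fr st oo r17 dJX QQ; apply: runs_seq.
pose Inv1 n s1 := [/\ stored (memory s1) stk I X, out s1 = o, reg s1 17 = v &
  forall u : 'I_w, u < n -> memory s1 (base_reach + u) = (u \in I)].
apply: (@runs_for d z f Inv1) => //.
  move=> u s1 fr1 [st1 oo1 r171 mR1] r11; have [_ mI1 _ _ _] := st1.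
  apply: runs_seq; apply: (@runs_GetBit _ _ _ base_in I u) => //;
    rewrite ?(frameE fr1) // /base_in /base_reach; first by lia.
  move=> s2 ag2 r2; have fr2 := agree_frame (n := 19) isT ag2 fr1.
  have [rr2 mm2 oo2] := ag2.
  apply: (@runs_PutBit _ _ _ base_reach (u \in I) u) => //; rewrite ?(frameE fr2) ?rr2 //.
  move=> s3 [rr3 oo3 mm3].
  have rr r : r < 19 -> reg s3 r = reg s1 r by move=> lt; rewrite rr3 ?rr2 //; lia.
  split; last by rewrite rr.
    by apply: frame_eq fr1 => r ?; apply: rr; lia.
  split; rewrite ?mm3 ?mm2 ?oo3 ?oo2 ?rr //; first exact: stored_reach.
  move=> u' lt /=; rewrite eqn_add2l val_eqE; case: eqP => [->//|ne].
  by apply: mR1; move: lt; rewrite ltnS leq_eqVlt => /orP[/eqP/val_inj/ne|].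
move=> s1 fr1 [st1 oo1 r171 mR1].
apply: runs_seq; apply: (@runs_PutBit _ _ _ base_reach 1 v) => //; rewrite ?(frameE fr1) //.
move=> s2 [rr2 oo2 mm2].
have fr2 : frame d z f s2.
  by apply: frame_eq fr1 => r ?; apply: rr2; lia.
pose Inv n s3 := exists S, deep n S /\ grown S (fun _ _ => False) s3.
apply: (@runs_for d z f Inv) => //.
(* Before the first round: a walk without edges ends where it starts, in [v |: I]. *)
- exists (v |: I); split; first by move=> x [|//] xJ.
  split; rewrite ?mm2 ?oo2 ?rr2 //; first exact: stored_reach.
  exists (v |: I); split=> //; first by apply: bits_add => u; rewrite mR1.
  by apply/subsetP=> x xJ; rewrite inE; apply/existsP; exists x; rewrite xJ /=.
- move=> n s3 fr3 [S [deepS gr3]] r11.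
  pose Inv' m s4 := reg s4 11 = n /\ grown S (fun u _ => u < m) s4.
  apply: (@runs_for d z f Inv') => //.
  + by split=> //; apply: grown_weaken gr3 _.
  + move=> u s4 fr4 [r114 gr4] r13.
    pose Inv2 m s5 := [/\ reg s5 11 = n, reg s5 13 = u &
      grown S (fun u' y => u' < u \/ u' = u /\ y < m) s5].
    apply: (@runs_for d z f Inv2) => //.
    * by split=> //; apply: grown_weaken gr4 _ => u' y [|[]].
    * move=> y s5 fr5 [r115 r135 gr5] r15.
      apply: (runs_Relax fr5 gr5 r115 r135 r15
        (P' := fun u' y' => u' < u \/ u' = u /\ y' < y.+1)) => [u' y'|s6 fr6 gr6 r116 r136 r156].
        case=> [|[-> ]]; first by left; left.
        rewrite ltnS leq_eqVlt => /orP[/eqP/val_inj->|]; first by right.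
        by left; right.
      by split.
    * move=> s5 fr5 [r115 r135 gr5]; split=> //; split=> //.
      apply: grown_weaken gr5 _ => u' y; rewrite ltnS leq_eqVlt.
      by case/orP=> [/eqP/val_inj->|]; [right | left].
  + move=> s4 fr4 [r114 gr4]; split=> //.
    have [st4 oo4 r174 [S' [mS' SS' S'T dS' closed]]] := gr4.
    exists S'; split; last by split=> //; exists S'; split.
    (* A walk of at most [n.+1] edges is cut before its last edge: the initial part ends in [S] by
       the previous rounds, and the last edge was relaxed in this one. *)
    move=> x p xJ; case/lastP: p => [|p y] /=; first by rewrite (subsetP SS') ?(deepS x [::]).
    rewrite rcons_path last_rcons size_rcons ltnS => /andP[pth].
    rewrite /induced /= !inE => /and3P[_ yNX euy] le.
    by apply: (closed _ _ _ _ euy yNX) => //; apply: deepS.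
move=> s3 fr3 [S [deepS [st3 oo3 r173 [S' [mS' SS' S'T dS' _]]]]].
apply: QQ => //; have <- // : S' = T.
by apply/eqP; rewrite eqEsubset S'T (subset_trans (deep_component deepS)).
Qed.

End Reaching.

(** * Counting the component and listing a solution *)

Lemma runs_Count d z f m o (v : 'I_w) S s (Q : state -> Prop) :
  frame d z f s -> memory s = m -> out s = o -> reg s 17 = v -> bits m base_reach S ->
  (forall s', frame d z f s' -> memory s' = m -> out s' = o -> reg s' 17 = v ->
     reg s' 18 = #|S| -> Q s') ->
  runs Count s Q.
Proof.
move=> fr mm oo r17 mS QQ.
apply: runs_seq; apply: (@runs_set _ _ 0) => //; first by lia.
pose Inv n s1 := [/\ memory s1 = m, out s1 = o, reg s1 17 = v &
  reg s1 18 = #|[set u in S | u < n]|].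
have le_w (C : {set 'I_w}) : #|C| <= w by rewrite -[leqRHS]card_ord max_card.
apply: (@runs_for d z f Inv) => //.
- by split=> //=; rewrite (_ : finset _ = set0) ?cards0 //; apply/setP=> u; rewrite !inE andbF.
- move=> u s1 fr1 [mm1 oo1 r171 r181] r11.
  apply: runs_seq; apply: (@runs_GetBit _ _ _ base_reach S u); rewrite ?mm1 ?(frameE fr1) //.
  move=> s2 ag2 r2; have fr2 := agree_frame (n := 19) isT ag2 fr1.
  have [rr2 mm2 oo2] := ag2.
  have cardE : #|[set x in S | x < u.+1]| = #|[set x in S | x < u]| + (u \in S).
    rewrite (cardsD1 u) !inE ltnSn andbT addnC; congr (_ + _); apply: eq_card => x.
    by rewrite !inE ltnS [x <= u]leq_eqVlt -val_eqE /=; case: (x \in S); rewrite ?andbF //=; lia.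
  apply: (@runs_set _ _ #|[set x in S | x < u.+1]|).
  + by rewrite /= r2 rr2 // r181 cardE.
  + by have := le_w [set x in S | x < u.+1]; nia.
  split; [exact: fr2| |by rewrite /= rr2].
  by split; rewrite /= ?mm2 ?oo2 ?rr2.
- move=> s1 fr1 [mm1 oo1 r171 r181]; apply: QQ => //; rewrite r181.
  by apply: eq_card => u; rewrite inE ltn_ord andbT.
Qed.

Lemma runs_Output d z f m o I s (Q : state -> Prop) :
  frame d z f s -> memory s = m -> out s = o -> bits m base_in I ->
  (forall s', frame d z f s' -> memory s' = m -> out s' = o ++ map val (enum I) -> Q s') ->
  runs Output s Q.
Proof.
move=> fr mm oo mI QQ.
pose Inv n s1 := memory s1 = m /\
  out s1 = o ++ [seq x <- iota 0 n | x \in map val (enum I)].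
apply: (@runs_for d z f Inv) => //; first by rewrite /Inv /= cats0.
  move=> u s1 fr1 [mm1 oo1] r11.
  have step : [seq x <- iota 0 u.+1 | x \in map val (enum I)] =
      [seq x <- iota 0 u | x \in map val (enum I)] ++ nseq (u \in I) (val u).
    rewrite -addn1 iotaD filter_cat /= add0n (mem_map val_inj) mem_enum.
    by case: (u \in I).
  apply: runs_seq; apply: (@runs_GetBit _ _ _ base_in I u);
    rewrite ?mm1 ?(frameE fr1) // /base_in /base_reach; first by lia.
  move=> s2 ag2 r2; have fr2 := agree_frame (n := 19) isT ag2 fr1.
  have [rr2 mm2 oo2] := ag2.
  apply: runs_if => [|r0].
    rewrite r2; case: (boolP (u \in I)) => // uI _; apply: runs_write.
    split; [exact: fr2| |by rewrite /= rr2].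
    by split; rewrite ?step ?uI /= ?mm2 // oo2 oo1 cats1 rcons_cat rr2 // r11.
  apply: runs_skip; split; [exact: fr2| |by rewrite /= rr2].
  split; rewrite ?mm2 // oo2 oo1 step.
  by move: r0; rewrite r2; case: (u \in I); rewrite ?cats0.
move=> s1 fr1 [mm1 oo1]; apply: QQ => //; rewrite oo1; congr (_ ++ _).
(* [enum] on ordinals follows increasing values, as does the loop. *)
rewrite -val_enum_ord filter_map; congr map; rewrite enumT [RHS]/enum_mem.
by apply: eq_filter => x; rewrite /= (mem_map val_inj) mem_enum.
Qed.

(** * One pass of the main loop *)

Lemma w_lt_B : w < B. Proof. lia. Qed.

Lemma k_lt_B : k < B. Proof. exact: leq_ltn_trans k_le_w w_lt_B. Qed.

Lemma frame_set7 d z f s x : frame d z f s -> frame x z f (set_reg s 7 x).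
Proof. by move=> fr; rewrite /frame /= !(frameE fr). Qed.

Lemma frame_set8 d z f s x : frame d z f s -> frame d x f (set_reg s 8 x).
Proof. by move=> fr; rewrite /frame /= !(frameE fr). Qed.

Lemma frame_set10 d z f s x : frame d z f s -> frame d z x (set_reg s 10 x).
Proof. by move=> fr; rewrite /frame /= !(frameE fr). Qed.

Lemma stored_in m stk I J X (v : 'I_w) x :
  stored m stk I X -> bits [eta m with base_in + v |-> x] base_in J ->
  stored [eta m with base_in + v |-> x] stk J X.
Proof.
have ltv := ltn_ord v; rewrite /base_in => -[mE _ mX mS szw] mJ; split=> //.
- by apply: adjacency_other => //; lia.
- by apply: bits_other => //; rewrite /base_ex; lia.
- by apply: stacked_other => //; rewrite /base_stack; lia.
Qed.

Lemma stored_ex m stk I J X (v : 'I_w) x :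
  stored m stk I X -> bits [eta m with base_ex + v |-> x] base_ex J ->
  stored [eta m with base_ex + v |-> x] stk I J.
Proof.
have ltv := ltn_ord v; rewrite /base_ex => -[mE mI _ mS szw] mJ; split=> //.
- by apply: adjacency_other => //; lia.
- by apply: bits_other => //; rewrite /base_in; lia.
- by apply: stacked_other => //; rewrite /base_stack; lia.
Qed.

Lemma stored_push m stk I X (v : 'I_w) :
  stored m stk I X -> size stk < w ->
  stored [eta m with base_stack + size stk |-> val v] (rcons stk v) I X.
Proof.
rewrite /base_stack => -[mE mI mX mS szw] ltw; split.
- by apply: adjacency_other => //; lia.
- by apply: bits_other => //; rewrite /base_in; lia.
- by apply: bits_other => //; rewrite /base_ex; lia.
- move=> j; rewrite size_rcons map_rcons nth_rcons size_map /base_stack /= eqn_add2l.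
  by rewrite ltnS leq_eqVlt; case: eqP => [->|_] /=; rewrite ?ltnn // => lt; rewrite lt mS.
- by rewrite size_rcons.
Qed.

Lemma stored_pop m stk I X (v : 'I_w) :
  stored m (rcons stk v) I X -> stored m stk I X /\ m (base_stack + size stk) = v.
Proof.
move=> [mE mI mX mS]; rewrite size_rcons => szw; split.
  split=> // [j lt|]; last exact: ltnW.
  by rewrite mS ?size_rcons ?ltnS ?(ltnW lt) // map_rcons nth_rcons size_map lt.
by rewrite mS ?size_rcons // map_rcons nth_rcons size_map ltnn eqxx.
Qed.

Definition represents stk I X f o s : Prop :=
  [/\ frame (size stk) #|I| f s, stored (memory s) stk I X & out s = o].

(** The outcomes are the three kinds of nodes: a solution, a dead end, and a node with a branching
    vertex. Room on the stack is assumed only when a candidate exists, since the stack may be full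
    at a leaf. *)
Lemma runs_Forward stk I X o s :
  represents stk I X 1 o s -> #|I| <= k -> [disjoint I & X] ->
  (forall v, candidate e I X v -> size stk < w) ->
  runs Forward s (fun s' =>
    [\/ #|I| = k /\ represents stk I X 0 (o ++ map val (enum I)) s',
        [/\ #|I| < k, forall v, ~~ candidate e I X v & represents stk I X 0 o s'] |
        exists v, [/\ #|I| < k, candidate e I X v &
          if k <= #|component e (v |: I) X| then represents (rcons stk v) (v |: I) X 1 o s'
          else represents (rcons stk v) I (v |: X) 1 o s']]).
Proof.
move=> [fr st oo] leIk dIX szw; have [mE mI mX mS _] := st.
apply: runs_seq; apply: (@runs_assign _ _ (k - #|I|)).
- by rewrite /= !(frameE fr).
- by nia.
move=> s1 ag1 r1; have fr1 := agree_frame (n := 19) isT ag1 fr; have [rr1 mm1 oo1] := ag1.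
apply: runs_if => [ne|eq0]; last first.
  have Ik : #|I| = k by move: eq0; rewrite r1; lia.
  apply: runs_seq; apply: (runs_Output fr1 mm1 (etrans oo1 oo) mI) => s2 fr2 mm2 oo2.
  apply: (@runs_set _ _ 0) => //; first by lia.
  constructor 1; split=> //; split; [exact: frame_set10 fr2 | |exact: oo2].
  by rewrite /= mm2.
have ltIk : #|I| < k by move: ne; rewrite r1; lia.
apply: runs_seq; apply: (runs_Find (stk := stk) (X := X) fr1); rewrite ?mm1 //.
move=> s2 fr2 mm2 oo2 found.
case: found => [[r18 none]|[r18 [v r17 cand]]]; apply: runs_if; rewrite r18 // => _.
  apply: (@runs_set _ _ 0) => //; first by lia.
  constructor 2; split=> //; split; [exact: frame_set10 fr2 | |].
  - by rewrite /= mm2.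
  - by rewrite /= oo2 oo1.
have ltstk := szw v cand; have ltv := ltn_ord v.
have [vNI vNX _] := and3P cand.
have dJX : [disjoint v |: I & X] by rewrite disjointsU1 vNX.
apply: runs_seq; apply: (runs_Reach (stk := stk) (o := o) fr2 _ _ r17 dJX).
- by rewrite mm2.
- by rewrite oo2 oo1.
move=> s3 fr3 st3 oo3 r173 mR.
apply: runs_seq; apply: (runs_Count fr3 erefl oo3 r173 mR) => s4 fr4 mm4 oo4 r174 r184.
set c := #|component e (v |: I) X| in r184 *.
apply: runs_seq; apply: (@runs_assign _ _ (k - c)).
- by rewrite /= r184 (frameE fr4).
- by nia.
move=> s5 ag5 r5; have fr5 := agree_frame (n := 19) isT ag5 fr4; have [rr5 mm5 oo5] := ag5.
have [m5E m5I m5X _ _] := st3.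
have finish J Y s6 : frame (size stk) #|J| 1 s6 -> stored (memory s6) stk J Y ->
    out s6 = o -> reg s6 17 = v ->
    runs (PutBit 5 7 17;; Assign 7 (Add 7 2)) s6 (represents (rcons stk v) J Y 1 o).
  move=> fr6 st6 oo6 r176; apply: runs_seq.
  apply: (@runs_PutBit _ _ _ base_stack v (size stk)); rewrite ?(frameE fr6) //.
    by rewrite /base_stack /base_reach; lia.
  move=> s7 [rr7 oo7 mm7].
  have fr7 : frame (size stk) #|J| 1 s7 by apply: frame_eq fr6 => r ?; apply: rr7; lia.
  apply: (@runs_set _ _ (size stk).+1); rewrite /= ?(frameE fr7) ?addn1 //; first by nia.
  split; rewrite /= ?oo7 ?mm7 //; last exact: stored_push.
  by rewrite size_rcons; apply: frame_set7 fr7.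
have reduce s' : (if k <= c then represents (rcons stk v) (v |: I) X 1 o s'
    else represents (rcons stk v) I (v |: X) 1 o s') ->
    [\/ #|I| = k /\ represents stk I X 0 (o ++ map val (enum I)) s',
        [/\ #|I| < k, forall v, ~~ candidate e I X v & represents stk I X 0 o s'] |
        exists v, [/\ #|I| < k, candidate e I X v &
          if k <= #|component e (v |: I) X| then represents (rcons stk v) (v |: I) X 1 o s'
          else represents (rcons stk v) I (v |: X) 1 o s']].
  by move=> rep; constructor 3; exists v.
apply: runs_seq; apply: runs_if => [ne5|eq5].
  have ltck : (k <= c) = false by apply/negbTE; move: ne5; rewrite r5; lia.
  apply: (@runs_PutBit _ _ _ base_ex 1 v); rewrite ?(frameE fr5) ?rr5 //.
    by rewrite /base_ex /base_reach; lia.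
  move=> s6 [rr6 oo6 mm6]; apply: runs_weaken (finish I (v |: X) s6 _ _ _ _) _.
  - by apply: frame_eq fr5 => r ?; apply: rr6; lia.
  - by rewrite mm6 mm5 mm4; apply: stored_ex st3 _; apply: bits_add.
  - by rewrite oo6 oo5.
  - by rewrite rr6 ?rr5.
  - by move=> s' rep; apply: reduce; rewrite ltck.
have lekc : k <= c by move: eq5; rewrite r5; lia.
apply: runs_seq; apply: (@runs_PutBit _ _ _ base_in 1 v); rewrite ?(frameE fr5) ?rr5 //.
  by rewrite /base_in /base_reach; lia.
move=> s6 [rr6 oo6 mm6].
have fr6 : frame (size stk) #|I| 1 s6 by apply: frame_eq fr5 => r ?; apply: rr6; lia.
apply: (@runs_set _ _ #|I|.+1); rewrite /= ?(frameE fr6) ?addn1 //; first exact: leq_ltn_trans ltIk k_lt_B.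
apply: runs_weaken (finish (v |: I) X _ _ _ _ _) _ => /=.
- by rewrite cardsU1 vNI add1n; apply: frame_set8 fr6.
- by rewrite mm6 mm5 mm4; apply: stored_in st3 _; apply: bits_add.
- by rewrite oo6 oo5.
- by rewrite rr6 ?rr5.
- by move=> s' rep; apply: reduce; rewrite lekc.
Qed.

(** The frame given to [Flip] already has the smaller stack size while the memory is still described
    with [v] on the stack, as needed when [v] is pushed back. *)
Lemma runs_pop stk J Y v o s (Q : state -> Prop) :
  represents (rcons stk v) J Y 0 o s ->
  (forall s', frame (size stk) #|J| 0 s' -> stored (memory s') (rcons stk v) J Y ->
     out s' = o -> reg s' 17 = v -> reg s' 18 = 0 -> reg s' 19 = (v \in J) ->
     runs Flip s' Q) ->
  runs Backward s Q.
Proof.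
move=> [fr st oo] QQ; have [_ top] := stored_pop st.
have [_ mJ _ _] := st; rewrite size_rcons => szw; have ltv := ltn_ord v.
rewrite size_rcons in fr.
apply: runs_if; rewrite (frameE fr) // => _.
apply: runs_seq; apply: (@runs_set _ _ (size stk)); rewrite /= ?(frameE fr) ?subn1 //.
  by apply: leq_trans szw (ltnW w_lt_B).
set s1 := set_reg _ _ _; have fr1 : frame (size stk) #|J| 0 s1 by apply: frame_set7 fr.
have mm1 : memory s1 = memory s by [].
have oo1 : out s1 = o by [].
move: {fr}s1 fr1 mm1 oo1 => s1 fr1 mm1 oo1.
apply: runs_seq; apply: runs_seq; apply: (@runs_assign _ _ (base_stack + size stk)).
- by rewrite /= !(frameE fr1).
- by rewrite /base_stack; lia.
move=> s2 ag2 r2; have [_ mm2 _] := ag2; apply: (@runs_assign _ _ v).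
- by rewrite /= r2 mm2 mm1.
- by apply: leq_ltn_trans (ltnW ltv) w_lt_B.
move=> s3 /(agree_trans ag2) ag3 r3.
have fr3 := agree_frame (n := 17) isT ag3 fr1; have [rr3 mm3 oo3] := ag3.
apply: runs_seq; apply: (@runs_GetBit _ _ _ base_in J v);
  rewrite ?mm3 ?mm1 ?(frameE fr3) // /base_in /base_reach; first by lia.
move=> s4 ag4 r4; have fr4 := agree_frame (n := 19) isT ag4 fr3; have [rr4 mm4 oo4] := ag4.
apply: runs_seq; apply: (@runs_set _ _ 0) => //; first by lia.
apply: QQ => //=.
- by rewrite mm4 mm3 mm1.
- by rewrite oo4 oo3.
- by rewrite rr4.
Qed.

Lemma runs_Backward_in stk I X v o s :
  represents (rcons stk v) (v |: I) X 0 o s -> v \notin I ->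
  runs Backward s (represents (rcons stk v) I (v |: X) 1 o).
Proof.
move=> rep vNI; apply: runs_pop rep _ => s1 fr1 st1 oo1 r17 r18 r19.
have [_ mI mX _] := st1; rewrite size_rcons => szw; have ltv := ltn_ord v.
have ltIw : #|I|.+1 <= w.
  by have := max_card (mem (v |: I)); rewrite card_ord cardsU1 vNI.
apply: runs_if; rewrite r19 setU11 // => _.
apply: runs_seq; apply: (@runs_PutBit _ _ _ base_in 0 v); rewrite ?(frameE fr1) //.
  by rewrite /base_in /base_reach; lia.
move=> s2 [rr2 oo2 mm2].
have fr2 : frame (size stk) #|v |: I| 0 s2 by apply: frame_eq fr1 => r ?; apply: rr2; lia.
rewrite cardsU1 vNI add1n in fr2.
apply: runs_seq; apply: (@runs_set _ _ #|I|); rewrite /= ?(frameE fr2) ?subn1 //.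
  exact: leq_trans ltIw (ltnW w_lt_B).
set s3 := set_reg _ _ _; have fr3 : frame (size stk) #|I| 0 s3 by apply: frame_set8 fr2.
apply: runs_seq; apply: (@runs_PutBit _ _ _ base_ex 1 v); rewrite ?(frameE fr3) //=.
- by rewrite rr2.
- by rewrite /base_ex /base_reach; lia.
move=> s4 [rr4 oo4 mm4].
have fr4 : frame (size stk) #|I| 0 s4 by apply: frame_eq fr3 => r ?; apply: rr4; lia.
apply: runs_seq; apply: (@runs_set _ _ (size stk).+1); rewrite /= ?(frameE fr4) ?addn1 //.
  exact: leq_ltn_trans szw w_lt_B.
apply: (@runs_set _ _ 1) => //; first by lia.
split; last by rewrite /= oo4 /= oo2.
- by rewrite size_rcons; apply: frame_set10 (frame_set7 _ fr4).
- rewrite /= mm4 /=; apply: (@stored_ex _ _ _ _ X).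
    rewrite mm2; apply: stored_in st1 _.
    by have := bits_remove v mI; rewrite setU1K.
  apply: bits_add; rewrite mm2; apply: bits_other => //; rewrite /base_in /base_ex; lia.
Qed.

Lemma runs_Backward_ex stk I X v o s :
  represents (rcons stk v) I (v |: X) 0 o s -> v \notin I -> v \notin X ->
  runs Backward s (represents stk I X 0 o).
Proof.
move=> rep vNI vNX; apply: runs_pop rep _ => s1 fr1 st1 oo1 r17 r18 r19.
have [st1' _] := stored_pop st1; have [_ _ mX _ _] := st1'.
apply: runs_if; rewrite r19 (negPf vNI) // => _.
apply: (@runs_PutBit _ _ _ base_ex 0 v); rewrite ?(frameE fr1) //.
  by rewrite /base_ex /base_reach; lia.
move=> s2 [rr2 oo2 mm2]; split; last by rewrite oo2.
- by apply: frame_eq fr1 => r ?; apply: rr2; lia.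
- rewrite mm2; apply: stored_ex st1' _.
  by have := bits_remove v mX; rewrite setU1K.
Qed.

Lemma runs_Backward_nil I X o s :
  represents [::] I X 0 o s -> runs Backward s (fun s' => reg s' 9 = 0 /\ out s' = o).
Proof.
move=> [fr _ oo]; apply: runs_if; rewrite (frameE fr) // => _.
by apply: (@runs_set _ _ 0) => //; lia.
Qed.

(** * Composition of passes of the main loop *)

Definition step_cost : nat := (cost w Body).+1.

(* In continuation style, so that partial runs of the main loop compose without
   an inductive definition. *)
Definition reaches s n (Q : state -> Prop) : Prop :=
  exists t s', [/\ forall t2 s2, exec B (While 9 Body) s' t2 s2 ->
      exec B (While 9 Body) s (t + t2) s2, t <= n * step_cost & Q s'].

Lemma reaches_refl s (Q : state -> Prop) : Q s -> reaches s 0 Q.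
Proof. by exists 0, s. Qed.

Lemma reaches_bind s n m (Q : state -> Prop) :
  reaches s n (fun s' => reaches s' m Q) -> reaches s (n + m) Q.
Proof.
move=> [t1 [s1 [ex1 le1 [t2 [s2 [ex2 le2 Qs]]]]]]; exists (t1 + t2), s2; split=> //.
- by move=> t3 s3 /ex2/ex1; rewrite addnA.
- by rewrite mulnDl leq_add.
Qed.

Lemma reaches_weaken s n m (Q Q' : state -> Prop) :
  reaches s n Q -> n <= m -> (forall s', Q s' -> Q' s') -> reaches s m Q'.
Proof.
move=> [t [s' [ex le Qs]]] nm QQ'; exists t, s'; split=> //; last exact: QQ'.
by rewrite (leq_trans le) // leq_mul2r nm orbT.
Qed.

Lemma reaches_step s (Q : state -> Prop) :
  reg s 9 = 1 -> runs Body s Q -> reaches s 1 Q.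
Proof.
move=> r9 [t [s' [ex le Qs]]]; exists t.+1, s'; split=> //; last by rewrite mul1n ltnS.
by move=> t2 s2 ex2; rewrite addSn; apply: exec_while_true ex2 => //; rewrite r9.
Qed.

Lemma runs_Body d z f s (Q : state -> Prop) :
  frame d z f s -> runs (if f == 0 then Backward else Forward) s Q -> runs Body s Q.
Proof.
by move=> fr; case: eqP => [f0|f0] run; apply: runs_if; rewrite (frameE fr).
Qed.

Lemma reaches_Body stk I X f o s (Q : state -> Prop) :
  represents stk I X f o s -> runs (if f == 0 then Backward else Forward) s Q ->
  reaches s 1 Q.
Proof.
by move=> [fr _ _] run; apply: reaches_step; [rewrite (frameE fr) | exact: runs_Body fr run].
Qed.

(** * Traversal of the search tree *)

Hypothesis e_sym : symmetric e.

Lemma perm_enum_disjointU (T : finType) (F G : {set T}) :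
  [disjoint F & G] -> perm_eq (enum F ++ enum G) (enum (F :|: G)).
Proof.
move=> dFG; apply: uniq_perm; rewrite ?enum_uniq // ?cat_uniq ?enum_uniq ?andbT /=.
  by apply/hasPn=> x; rewrite !mem_enum => xG; rewrite (disjointFl dFG).
by move=> x; rewrite mem_cat !mem_enum inE.
Qed.

Lemma listing_cat (l1 l2 : seq {set 'I_w}) : listing (l1 ++ l2) = listing l1 ++ listing l2.
Proof. by rewrite /listing map_cat flatten_cat. Qed.

(* Twice the number of nodes of the search tree with [u] undecided vertices and
   [n] solutions, minus one: the loop visits each node once going forward, and
   backtracks once into the parent of each node but the root.  A node without
   solutions is followed only by exclusions. *)
Definition steps (n u : nat) : nat := 2 * (n * u ^ 2 + u) + 1.

Lemma candidate_room I X v :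
  [disjoint I & X] -> candidate e I X v -> #|I| + #|X| < w.
Proof.
move=> dIX /and3P[vNI vNX _]; have := max_card (mem (v |: (I :|: X))).
by rewrite card_ord cardsU1 inE negb_or vNI vNX cardsU disjoint_setI0 // cards0 subn0.
Qed.

(** The 2 pays for the forward pass at a node and the backward pass from its only child. *)
Lemma steps_exclude n u : steps n u + 2 <= steps n u.+1.
Proof. by rewrite /steps -!mulnn; nia. Qed.

(** The 3 pays for the forward pass and the backward passes from both children. Two children bring
    the linear term of [steps] twice; as [n1] is positive, the growth of [n1 * u ^ 2] absorbs the
    second copy. *)
Lemma steps_branch n1 n2 u :
  0 < n1 -> steps n1 u + steps n2 u + 3 <= steps (n1 + n2) u.+1.
Proof.
rewrite /steps -!mulnn => n1_gt0.
have : u <= n1 * u by rewrite leq_pmull.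
nia.
Qed.

(** Induction on the number [u] of undecided vertices. The run ends with the same [I], [X] and stack
    as it began, only turned to backtracking, so the explorations of the two children can be
    chained. *)
Lemma reaches_explore u : forall stk I X o s,
  #|I| <= k -> [disjoint I & X] -> connected_in e I -> size stk = #|I| + #|X| ->
  size stk + u = w -> represents stk I X 1 o s ->
  reaches s (steps #|solutions e k I X| u) (fun s' =>
    exists2 l, perm_eq l (enum (solutions e k I X)) &
      represents stk I X 0 (o ++ listing l) s').
Proof.
elim/ltn_ind: u => u IHu stk I X o s leIk dIX cI szstk szu rep.
have room v : candidate e I X v -> size stk < w.
  by rewrite szstk; apply: candidate_room.
have steps_pos n : steps n u = 1 + (steps n u).-1 by rewrite /steps; lia.
rewrite steps_pos; apply: reaches_bind; apply: (reaches_Body rep).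
apply: runs_weaken (runs_Forward rep leIk dIX room) _ => s1.
case=> [[Ik rep1]|[ltIk none rep1]|[v [ltIk cand]]].
- apply: reaches_weaken (reaches_refl _) (leq0n _) _ => [|s' Q]; last exact: Q.
  exists [:: I]; last by rewrite /listing /= cats0.
  by rewrite solutions_full // enum_set1.
- apply: reaches_weaken (reaches_refl _) (leq0n _) _ => [|s' Q]; last exact: Q.
  exists [::]; last by rewrite /listing cats0.
  by rewrite solutions_no_candidate // enum_set0.
have [vNI vNX adj] := and3P cand; have ltsz := room v cand.
have [u' uE] : exists u', u = u'.+1 by exists u.-1; lia.
have szr : size (rcons stk v) + u' = w by rewrite size_rcons; lia.
(* The exclusion branch, entered either at once or after the inclusion branch; its last pass removes
   [v] from [X] again. *)
have explore_ex s2 o2 : represents (rcons stk v) I (v |: X) 1 o2 s2 ->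
    reaches s2 (steps #|solutions e k I (v |: X)| u' + 1) (fun s' =>
      exists2 l, perm_eq l (enum (solutions e k I (v |: X))) &
        represents stk I X 0 (o2 ++ listing l) s').
  move=> rep2; apply: reaches_bind.
  apply: reaches_weaken (IHu u' _ (rcons stk v) I (v |: X) o2 s2 _ _ _ _ _ _) (leqnn _) _ => //.
  - by rewrite uE.
  - by rewrite disjoint_sym disjointsU1 vNI disjoint_sym.
  - by rewrite size_rcons cardsU1 vNX szstk; lia.
  move=> s3 [l lP rep3]; apply: (reaches_Body rep3) => /=.
  by apply: runs_weaken (runs_Backward_ex rep3 vNI vNX) _ => s4 rep4; exists l.
have splitE := solutions_split e k I X v.
(* If the component is too small, no solution contains [v] and the exclusion branch finds them
   all. *)
case: leqP => [lekc|ltck] rep1; last first.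
  rewrite splitE (solutions_small_component ltck) set0U.
  apply: reaches_weaken (explore_ex _ _ rep1) _ _ => //.
  by have := steps_exclude #|solutions e k I (v |: X)| u'; rewrite uE; lia.
have solI := solutions_large_component e_sym cI dIX cand ltIk lekc.
rewrite splitE cardsU disjoint_setI0 ?disjoint_solutions // cards0 subn0.
set n1 := #|solutions e k (v |: I) X|; set n2 := #|solutions e k I (v |: X)|.
have n1_gt0 : 0 < n1 by rewrite card_gt0.
(* Exploration with [v], the pass that moves [v] from [I] to [X], then exploration without [v] and
   its closing pass. The predecessor accounts for the forward pass already made. *)
have le_steps : steps n1 u' + (1 + (steps n2 u' + 1)) <= (steps (n1 + n2) u).-1.
  by have := steps_branch n2 u' n1_gt0; rewrite uE; lia.
apply: reaches_weaken le_steps (fun _ => id); apply: reaches_bind.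
apply: reaches_weaken (IHu u' _ (rcons stk v) (v |: I) X o s1 _ _ _ _ _ rep1) (leqnn _) _ => //.
- by rewrite uE.
- by rewrite cardsU1 vNI.
- by rewrite disjointsU1 vNX.
- exact: connected_setU1.
- by rewrite size_rcons cardsU1 vNI szstk.
move=> s2 [l1 l1P rep2]; apply: reaches_bind; apply: (reaches_Body rep2) => /=.
apply: runs_weaken (runs_Backward_in rep2 vNI) _ => s3 rep3.
apply: reaches_weaken (explore_ex _ _ rep3) (leqnn _) _ => s4 [l2 l2P rep4].
exists (l1 ++ l2); last by rewrite listing_cat catA.
apply: perm_trans (perm_cat l1P l2P) _.
exact: perm_enum_disjointU (disjoint_solutions _ _ _ _ _).
Qed.

(** * Initial state and total running time *)

Lemma stored_input : stored (memory (input e k)) [::] set0 set0.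
Proof.
have outside a : w * w <= a -> memory (input e k) a = 0.
  move=> le /=; apply/eqP; rewrite eqb0; apply/existsP=> -[i /existsP[j /andP[/eqP aE _]]].
  by have := ltn_ord i; have := ltn_ord j; nia.
split=> //.
- move=> u v /=; congr nat_of_bool; apply/existsP/idP => [[i /existsP[j]]|euv].
    (* Quotient and remainder by [w] recover row and column from the address. *)
    case/andP=> /eqP E; have [<- <- //] : i = u /\ j = v.
    have := ltn_ord j; have := ltn_ord v => ltv ltj.
    by split; apply: val_inj; have := congr1 (divn^~ w) E; have := congr1 (modn^~ w) E;
      rewrite !modnMDl !divnMDl // !divn_small ?modn_small // !addn0.
  by exists u; apply/existsP; exists v; rewrite eqxx.
- by move=> u; rewrite outside ?inE // /base_in; lia.
- by move=> u; rewrite outside ?inE // /base_ex; lia.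
Qed.

Lemma runs_Init : runs Init (input e k) (represents [::] set0 set0 1 [::]).
Proof.
rewrite /Init.
apply: runs_seq; apply: (@runs_set _ _ 1) => //; first by lia.
apply: runs_seq; apply: (@runs_set _ _ base_in) => //; first by rewrite /base_in; lia.
apply: runs_seq; apply: (@runs_set _ _ base_ex) => //; first by rewrite /base_ex; lia.
apply: runs_seq; apply: (@runs_set _ _ base_stack) => //; first by rewrite /base_stack; lia.
apply: runs_seq; apply: (@runs_set _ _ base_reach) => //; first by rewrite /base_reach; lia.
apply: runs_seq; apply: (@runs_set _ _ 1) => //; first by lia.
apply: (@runs_set _ _ 1) => //; first by lia.
split=> //; last exact: stored_input.
by rewrite /frame /frame_regs cards0.
Qed.

(** The program being fixed, its cost unfolds to a cubic polynomial in [w]. Lower powers are at most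
    [w ^ 3], and the coefficients add up to at most 200. *)
Lemma step_cost_le : step_cost <= 200 * w ^ 3.
Proof.
rewrite /step_cost /Body /= !expnS expn0 muln1.
have w1 : w <= w * w by rewrite leq_pmull.
have w2 : w * w <= w * (w * w) by rewrite leq_mul2l w1 orbT.
nia.
Qed.

Lemma exec_Enumerate :
  connected_in e [set: 'I_w] -> 0 < k ->
  exists t s, [/\ exec B Enumerate (input e k) t s, enumerates (ksubtrees e k) (out s) &
    t <= 2000 * (#|ksubtrees e k| * w ^ 5)].
Proof.
move=> cT k_gt0.
have N_gt0 : 0 < #|ksubtrees e k|.
  by rewrite card_gt0 ksubtrees_neq0 // card_ord k_gt0.
have [t0 [s0 [ex0 le0 rep0]]] := runs_Init.
have : reaches s0 (steps #|ksubtrees e k| w + 1)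
    (fun s' => reg s' 9 = 0 /\ enumerates (ksubtrees e k) (out s')).
  apply: reaches_bind; rewrite -solutions_top.
  apply: reaches_weaken (reaches_explore _ _ _ _ _ rep0) (leqnn _) _.
  - by rewrite cards0.
  - by rewrite disjoints_subset sub0set.
  - by apply/forall_inP=> x; rewrite inE.
  - by rewrite !cards0.
  - by [].
  move=> s1 [l lP rep1]; apply: (reaches_Body rep1) => /=.
  by apply: runs_weaken (runs_Backward_nil rep1) _ => s2 [r9 ->]; split=> //; exists l.
move=> [t1 [s1 [ex1 le1 [r9 enum1]]]].
exists (t0 + (t1 + 1)), s1; split=> //.
  by apply: exec_seq ex0 (ex1 _ _ (exec_while_false _ _ r9)).
set N := #|ksubtrees e k| in N_gt0 le1 *.
have w_pow : w ^ 5 = w ^ 2 * w ^ 3 by rewrite -expnD.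
have w_le : w <= w ^ 2 by rewrite -mulnn leq_pmull.
have w2_le : w ^ 2 <= N * w ^ 2 by rewrite leq_pmull.
(* The [+ 1] is the last pass, which finds the stack empty. Six copies suffice because 1 and [w] are
   at most [N * w ^ 2]. *)
have steps_le : steps N w + 1 <= 6 * (N * w ^ 2) by rewrite /steps; lia.
have w5_gt0 : 0 < N * w ^ 5 by rewrite muln_gt0 N_gt0 expn_gt0 w_gt0.
(* 1200 is 6 times 200; the rest of 2000 more than covers initialisation and the failing loop
   test. *)
have t1_le : t1 <= 1200 * (N * w ^ 5).
  apply: leq_trans le1 _; apply: leq_trans (leq_mul steps_le step_cost_le) _.
  by rewrite w_pow; lia.
by move: le0; rewrite /=; lia.
Qed.

End Machine.

(** As [w] is below [2 ^ (trunc_log 2 w).+1], the word bound is at least [w.+1 ^ 3], which exceeds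
    every address used; [w.+1 ^ 2] would fall short of [w * w + 4 * w]. *)
Lemma word_bound_large w : 0 < w -> w * w + 4 * w < word_bound 3 w.
Proof.
move=> w_gt0; rewrite /word_bound [3 * _]mulnC expnM.
have /(_ w) : forall n, n < 2 ^ (trunc_log 2 n).+1 by move=> n; rewrite trunc_log_ltn.
move=> lt; apply: leq_trans (_ : w.+1 ^ 3 <= _); last by rewrite leq_exp2r.
by rewrite !expnS expn0 muln1; nia.
Qed.

Theorem corollary4 :
  exists (A : prog) (L C : nat),
    forall (w : nat) (e : rel 'I_w) (k : nat),
      is_tree e -> 0 < k <= w ->
      exists (t : nat) (s : state),
        [/\ exec (word_bound L w) A (input e k) t s,
            enumerates (ksubtrees e k) (out s)
          & t <= C * (#|ksubtrees e k| * w ^ 5)].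
Proof.
exists Enumerate, 3, 2000 => w e k [e_sym _ conn _] /andP[k_gt0 k_le_w].
have w_gt0 : 0 < w by apply: leq_trans k_le_w.
exact: exec_Enumerate (word_bound_large w_gt0) w_gt0 k_le_w e_sym conn k_gt0.
Qed.
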